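(* Let $x_1,x_2,\ldots,x_{n_1}$ and $y_1,y_2,\ldots,y_{n_2}$, $n_1+n_2=n$, be independent univariate samples from unknown continuous distributions $F_X$ and $F_Y$. For $1\le i,j,k,l\le n$ define $$a_{i,j,k,l}=\begin{cases}+\frac12&\text{if }1\le i\le n_1,\ n_1+1\le j\le n\text{ and }1\le k<l\le n,\\ -\frac12&\text{if }1\le i\le n_1,\ n_1+1\le j\le n\text{ and }1\le l<k\le n,\\ 0&\text{otherwise.}\end{cases}$$ Let $\pi$ be a permutation chosen uniformly at random from the symmetric group $S_n$ and let $$V_1=\sum_{s\ne t}a_{s,t,\pi(s),\pi(t)}.$$ Then $W_1=n^{-3/2}V_1$ satisfies, for all $t>0$, $$P(W_1\ge t)\le\exp\left(-\frac{t^2n}{4(2n-1)(6+4/n+1/n^2)}\right)\quad\text{and}\quad P(W_1\le -t)\le\exp\left(-\frac{t^2n}{4(2n-1)(6+4/n+1/n^2)}\right).$$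
   Context: The sum $\sum_{s\ne t}$ runs over all ordered pairs $(s,t)$ with $s,t\in\{1,\dots,n\}$, $s\neq t$. The samples enter $V_1$ only through their sizes $n_1,n_2$. (Under the null hypothesis $F_X=F_Y$, the rank vector of the pooled sample $(x_1,\dots,x_{n_1},y_1,\dots,y_{n_2})$ is a uniform random permutation $\pi$, and with this $\pi$ the variable $V_1$ is the centered Mann-Whitney-Wilcoxon statistic $|\{(i,j):x_i<y_j\}|-n_1n_2/2$.) *)

(* Defs.v *)
From mathcomp Require Import all_boot all_order all_algebra perm.
From mathcomp Require Import all_classical all_reals all_analysis.

Set Implicit Arguments.
Unset Strict Implicit.
Unset Printing Implicit Defensive.

Import Order.TTheory GRing.Theory Num.Theory.

Local Open Scope classical_set_scope.
Local Open Scope ring_scope.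

(* Indices are 0-based: 1 <= i <= n1 becomes i < n1 and n1 + 1 <= j <= n
   becomes n1 <= j. *)
Definition mww_coef (R : realType) (n1 n : nat) (i j k l : 'I_n) : R :=
  if [&& (i < n1)%N, (n1 <= j)%N & (k < l)%N] then 1 / 2
  else if [&& (i < n1)%N, (n1 <= j)%N & (l < k)%N] then - (1 / 2)
  else 0.

Definition V1 (R : realType) (n1 n : nat) (p : 'S_n) : R :=
  \sum_(st : 'I_n * 'I_n | st.1 != st.2)
     mww_coef R n1 st.1 st.2 (p st.1) (p st.2).

Definition W1 (R : realType) (n1 n : nat) (p : 'S_n) : R :=
  n%:R `^ (- (3 / 2)) * V1 R n1 p.

(* {perm 'I_n} carries no measurable structure in the library; for a map into a
   finite set, measurability of the fibres is measurability for the discrete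
   sigma-algebra. *)
Definition uniform_perm (d : measure_display) (Omega : measurableType d)
    (R : realType) (P : probability Omega R) (n : nat) (p : Omega -> 'S_n) :
    Prop :=
  forall s : 'S_n, measurable (p @^-1` [set s]) /\
    P (p @^-1` [set s]) = ((#|{: 'S_n}|%:R)^-1)%:E.

(* Main.v *)
Require Import Defs.
From mathcomp Require Import all_boot all_order all_algebra perm.
From mathcomp Require Import all_classical all_reals all_analysis.
From mathcomp Require Import ring lra.

Set Implicit Arguments.
Unset Strict Implicit.
Unset Printing Implicit Defensive.

Import Order.TTheory GRing.Theory Num.Theory.

Local Open Scope classical_set_scope.
Local Open Scope ring_scope.

(** Identify the index set with Z/n. The pairs (s, s + r) with s in the first
    sample and s + r in the second are disjoint for fixed r, so V1 is a sum of
    n sums S_r, each consisting of at most n independent symmetric terms of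
    absolute value 1/2. Convexity of exp gives
    E exp(lambda V1) <= max_r E exp(lambda n S_r) <= exp(lambda^2 n^3 / 2),
    and Chernoff's bound yields exp(-t^2 / 2), which is stronger than
    required. *)

(** For [x >= 1/2] both exponents are at most [2 * x ^+ 2]. For [0 <= x < 1/2], multiplying
    [1 - x <= expR (- x)] and [1 + x <= expR x] by the inverse exponentials bounds the sum by
    [2 / (1 - x ^+ 2)], which is at most [2 * (1 + 2 * x ^+ 2)]. The constant 2 is not sharp, but it
    suffices. *)
Lemma expR_add_opp_le (R : realType) (x : R) :
  expR x + expR (- x) <= 2 * expR (2 * x ^+ 2).
Proof.
wlog x0 : x / 0 <= x.
  move=> H; have [|/ltW x0] := leP 0 x; first exact: H.
  by have := H (- x); rewrite oppr_ge0 opprK sqrrN addrC; apply.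
have [xh|xh] := leP (1 / 2) x.
  have h1 : expR x <= expR (2 * x ^+ 2) by rewrite ler_expR; nra.
  have h2 : expR (- x) <= expR (2 * x ^+ 2) by rewrite ler_expR; nra.
  lra.
have hp := expR_ge1Dx x; have hm := expR_ge1Dx (- x).
have hu := expR_ge1Dx (2 * x ^+ 2).
have hinv : expR x * expR (- x) = 1 by rewrite -expRD subrr expR0.
have p0 := expR_gt0 x; have m0 := expR_gt0 (- x).
have e1 : expR x * (1 - x) <= 1 by nra.
have e2 : expR (- x) * (1 + x) <= 1 by nra.
have e1' : expR x <= (1 - x)^-1.
  by rewrite -[leRHS]mul1r ler_pdivlMr //; lra.
have e2' : expR (- x) <= (1 + x)^-1.
  by rewrite -[leRHS]mul1r ler_pdivlMr //; lra.
have x2 : x ^+ 2 < 1 / 4 by nra.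
have x20 := sqr_ge0 x.
have einv : (1 - x)^-1 + (1 + x)^-1 = 2 / (1 - x ^+ 2).
  by field; apply/and3P; split; rewrite gt_eqF //; lra.
have : 2 / (1 - x ^+ 2) <= 2 * (1 + 2 * x ^+ 2).
  by rewrite ler_pdivrMr; [nra | lra].
lra.
Qed.

(** Jensen's inequality for exp: bound each term below by the tangent at the mean [A] of the values
    [N * a i]; the linear parts sum to zero. *)
Lemma expR_sum_le_mean (R : realType) (I : finType) (a : I -> R) :
  #|I|%:R * expR (\sum_i a i) <= \sum_i expR (#|I|%:R * a i).
Proof.
set N : R := #|I|%:R; set A := \sum_i a i.
have tangent i : expR A * (1 + (N * a i - A)) <= expR (N * a i).
  rewrite -[in leRHS](subrKC A (N * a i)) expRD ler_pM2l ?expR_gt0 //.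
  exact: expR_ge1Dx.
apply: le_trans (ler_sum _ (fun i _ => tangent i)).
rewrite -mulr_sumr !big_split /= sumrN -mulr_sumr !sumr_const -/A.
rewrite -[A *+ _]mulr_natl -/N subrr addr0 mulrC.
by rewrite /N; lra.
Qed.

Section MGF.
Variables (R : realType) (n1 : nat).

Lemma mww_coef_antisym n (i j k l : 'I_n) :
  mww_coef R n1 i j l k = - mww_coef R n1 i j k l.
Proof.
rewrite /mww_coef; case: (i < n1)%N; case: (n1 <= j)%N => /=; rewrite ?oppr0 //.
by case: (ltngtP k l) => _; rewrite ?oppr0 ?opprK.
Qed.

Lemma mww_coef_sqr n (i j k l : 'I_n) : mww_coef R n1 i j k l ^+ 2 <= 1 / 4.
Proof. by rewrite /mww_coef; (case: ifP => _; last case: ifP => _); lra. Qed.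

Lemma mww_coef_out n (i j k l : 'I_n) :
  ~~ ((i < n1)%N && (n1 <= j)%N) -> mww_coef R n1 i j k l = 0.
Proof. by rewrite /mww_coef; case: (i < n1)%N => //; case: (n1 <= j)%N. Qed.

(* The swap [tperm s (s + r)] flips the sign of the s-th factor and fixes the
   others, so averaging over it replaces that factor by a cosh. *)
Lemma matching_mgf n (r : 'I_n.+1) (c : R) (e : seq 'I_n.+1) : uniq e ->
  \sum_(p : 'S_n.+1) \prod_(s <- e)
      expR (c * mww_coef R n1 s (s + r) (p s) (p (s + r)))
    <= #|{: 'S_n.+1}|%:R * expR (c ^+ 2 / 2) ^+ size e.
Proof.
elim: e => [_|s e IH /= /andP[se ue]].
  by under eq_bigr do rewrite big_nil; rewrite sumr_const /= mulr1.
pose f i (p : 'S_n.+1) := expR (c * mww_coef R n1 i (i + r) (p i) (p (i + r))).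
pose F p := \prod_(i <- e) f i p.
under eq_bigr => p _ do rewrite big_cons -/(f s p) -/(F p).
rewrite exprS mulrCA.
suff step : \sum_p f s p * F p <= expR (c ^+ 2 / 2) * \sum_p F p.
  by apply: le_trans step _; rewrite ler_pM2l ?expR_gt0 // IH.
have F0 p : 0 <= F p by apply: prodr_ge0 => i _; exact: expR_ge0.
(* If the pair does not go from the first sample to the second, its factor is [expR 0]. *)
have [sA|sA] := boolP ((s < n1)%N && (n1 <= (s + r)%R)%N); last first.
  rewrite mulr_sumr; apply: ler_sum => p _; apply: ler_wpM2r => //.
  by rewrite /f mww_coef_out // mulr0 ler_expR; have := sqr_ge0 c; lra.
pose tau := tperm s (s + r).
(* Every other pair that counts is disjoint from [{s, s + r}]: translation by [r] is injective, and
   first-sample indices never equal second-sample ones. *)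
have Ftau p : F (tau * p)%g = F p.
  rewrite /F; apply: eq_big_seq => i ie; congr (expR (c * _)).
  have [iA|iA] := boolP ((i < n1)%N && (n1 <= (i + r)%R)%N); last first.
    by rewrite !mww_coef_out.
  have is_ : s != i by apply: contraNneq se => ->.
  case/andP: sA => s1 s2; case/andP: iA => i1 i2.
  rewrite !permM !tpermD //.
  - by apply: contraTneq s1 => ->; rewrite -leqNgt.
  - by rewrite (inj_eq (addIr r)).
  - by apply: contraTneq i1 => <-; rewrite -leqNgt.
have ftau p : f s p + f s (tau * p)%g <= 2 * expR (c ^+ 2 / 2).
  rewrite /f !permM tpermL tpermR (mww_coef_antisym s (s + r) (p s)) mulrN.
  apply: le_trans (expR_add_opp_le _) _.
  rewrite exprMn ler_pM2l // ler_expR.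
  have := ler_wpM2l (sqr_ge0 c) (mww_coef_sqr s (s + r) (p s) (p (s + r))).
  lra.
have sym : \sum_p f s p * F p = \sum_p f s (tau * p)%g * F p.
  rewrite (reindex_inj (mulgI tau)); apply: eq_bigr => p _.
  by rewrite Ftau.
suff: 2 * (\sum_p f s p * F p) <= 2 * (expR (c ^+ 2 / 2) * \sum_p F p).
  by rewrite ler_pM2l.
rewrite mulr2n mulrDl mul1r {2}sym -big_split /= -mulr2n mulrA mulr_sumr.
by apply: ler_sum => p _; rewrite -mulrDl ler_wpM2r.
Qed.

Lemma V1_matchings n (p : 'S_n.+1) :
  V1 R n1 p = \sum_(r : 'I_n.+1) \sum_(s : 'I_n.+1)
    mww_coef R n1 s (s + r) (p s) (p (s + r)).
Proof.
rewrite /V1 exchange_big /= big_mkcond /=.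
rewrite -(pair_bigA _ (fun s t => if s != t then mww_coef R n1 s t (p s) (p t) else 0)) /=.
apply: eq_bigr => s _; rewrite (reindex_inj (addrI s)) /=.
apply: eq_bigr => r _; case: eqP => //= <-.
(* The shift [r = 0] gives the diagonal, where the coefficient vanishes since no index lies in both
   samples. *)
by rewrite mww_coef_out // [(n1 <= _)%N]leqNgt andbN.
Qed.

Lemma V1_mgf n (lambda : R) :
  \sum_(p : 'S_n.+1) expR (lambda * V1 R n1 p) <=
  #|{: 'S_n.+1}|%:R * expR (lambda ^+ 2 * n.+1%:R ^+ 3 / 2).
Proof.
set N : R := n.+1%:R; have N0 : 0 < N by rewrite ltr0n.
rewrite -(ler_pM2l N0) mulr_sumr.
pose S p (r : 'I_n.+1) : R :=
  \sum_(s : 'I_n.+1) mww_coef R n1 s (s + r) (p s) (p (s + r)).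
apply: (@le_trans _ _ (\sum_(p : 'S_n.+1) \sum_r expR (N * (lambda * S p r)))).
  apply: ler_sum => p _; rewrite V1_matchings mulr_sumr.
  have := @expR_sum_le_mean R 'I_n.+1 (fun r => lambda * S p r).
  by rewrite card_ord.
rewrite exchange_big /=.
have bnd r : \sum_(p : 'S_n.+1) expR (N * (lambda * S p r)) <=
    #|{: 'S_n.+1}|%:R * expR (lambda ^+ 2 * N ^+ 3 / 2).
  have := matching_mgf r (N * lambda) (index_enum_uniq 'I_n.+1).
  rewrite -expRM_natl.
  have -> : size (index_enum 'I_n.+1) = n.+1.
    by rewrite -[RHS]card_ord cardT enumT.
  (* Two powers of [N] come from the convexity step, the third from the number of factors in a
     matching. *)
  have -> : n.+1%:R * ((N * lambda) ^+ 2 / 2) = lambda ^+ 2 * N ^+ 3 / 2.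
    by rewrite -/N; ring.
  apply: le_trans; apply: ler_sum => p _.
  by rewrite -expR_sum mulrA mulr_sumr.
apply: le_trans (ler_sum _ (fun r _ => bnd r)) _.
by rewrite sumr_const card_ord -[leLHS]mulr_natl.
Qed.

Lemma W1_mgf n (mu : R) : (0 < n)%N ->
  \sum_(p : 'S_n) expR (mu * W1 R n1 p) <=
  #|{: 'S_n}|%:R * expR (mu ^+ 2 / 2).
Proof.
case: n => // n _; rewrite /W1.
under eq_bigr do rewrite mulrA.
apply: le_trans (V1_mgf _ _) _.
suff -> : (mu * n.+1%:R `^ (- (3 / 2))) ^+ 2 * n.+1%:R ^+ 3 = mu ^+ 2 by [].
rewrite exprMn -mulrA -(powR_mulrn 2 (powR_ge0 _ _)) -powRrM.
(* The exponents add up to 0, so merging the powers requires a nonzero base. *)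
rewrite -powR_mulrn // -powRD; last by rewrite pnatr_eq0 implybT.
have -> : - (3 / 2) * 2 + 3 = 0 :> R by lra.
by rewrite powRr0 mulr1.
Qed.

End MGF.

(** The event is a finite disjoint union of measurable fibres, so additivity applies. *)
Lemma uniform_perm_prob (R : realType) (d : measure_display)
    (Omega : measurableType d) (P : probability Omega R) (n : nat)
    (p : Omega -> 'S_n) (A : pred 'S_n) : uniform_perm P p ->
  P [set w | A (p w)] = (\sum_(s | A s) (#|{: 'S_n}|%:R)^-1)%:E.
Proof.
move=> unif.
have -> : [set w | A (p w)] = \bigcup_(s in [set` A]) (p @^-1` [set s]).
  apply/seteqP; split => [w /= Aw|w /= [s] /= As ps]; first by exists (p w).
  by rewrite ps.
rewrite measure_fin_bigcup //; last by move=> s _; have [] := unif s.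
- rewrite -(@bigfs _ _ _ _ (index_enum _)) ?index_enum_uniq //; last first.
    by move=> s _; rewrite mem_index_enum.
  by rewrite -sumEFin; apply: eq_bigr => s _; exact: (unif s).2.
- exact: trivIset_preimage1.
Qed.

(* Chernoff bound; both tails are the cases [mu = t] and [mu = - t]. *)
Lemma W1_tail (R : realType) (d : measure_display)
    (Omega : measurableType d) (P : probability Omega R) (n1 n : nat)
    (p : Omega -> 'S_n) (A : pred 'S_n) (mu : R) :
  (0 < n)%N -> uniform_perm P p ->
  (forall s, A s -> mu ^+ 2 <= mu * W1 R n1 s) ->
  (P [set w | A (p w)] <= (expR (- (mu ^+ 2 / 2)))%:E)%E.
Proof.
move=> n0 unif hA; rewrite (uniform_perm_prob A unif).
have c0 : 0 < #|{: 'S_n}|%:R :> R.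
  by rewrite ltr0n; apply/card_gt0P; exists 1%g.
rewrite lee_fin.
under eq_bigr do rewrite -[_^-1]mul1r.
rewrite -mulr_suml ler_pdivrMr // mulrC.
have -> : expR (- (mu ^+ 2 / 2)) = expR (mu ^+ 2 / 2) * expR (- mu ^+ 2).
  by rewrite -expRD; congr expR; lra.
rewrite mulrA.
apply: le_trans (ler_wpM2r (expR_ge0 _) (W1_mgf n1 mu n0)).
(* Markov's inequality termwise: the indicator of [A] is at most
   [expR (mu * W1 R n1 s - mu ^+ 2)]. *)
rewrite mulr_suml big_mkcond /=; apply: ler_sum => s _; rewrite -expRD.
case: ifP => [/hA As|_]; last exact: expR_ge0.
by rewrite -expR0 ler_expR; lra.
Qed.

Theorem proposition4p1 (R : realType) (d : measure_display)
    (Omega : measurableType d) (P : probability Omega R)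
    (n1 n2 n : nat) (n12 : (n1 + n2)%N = n) (n_gt0 : (0 < n)%N)
    (pi : Omega -> 'S_n) (pi_unif : uniform_perm P pi)
    (t : R) (t_gt0 : 0 < t) :
  (P [set w | (W1 R n1 (pi w) >= t)%R] <=
    (expR (- (t ^+ 2 * n%:R /
       (4 * (2 * n%:R - 1) * (6 + 4 / n%:R + 1 / n%:R ^+ 2)))))%:E)%E /\
  (P [set w | (W1 R n1 (pi w) <= - t)%R] <=
    (expR (- (t ^+ 2 * n%:R /
       (4 * (2 * n%:R - 1) * (6 + 4 / n%:R + 1 / n%:R ^+ 2)))))%:E)%E.
Proof.
have weaken : expR (- (t ^+ 2 / 2)) <= expR (- (t ^+ 2 * n%:R /
       (4 * (2 * n%:R - 1) * (6 + 4 / n%:R + 1 / n%:R ^+ 2)))).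
  have N1 : 1 <= n%:R :> R by rewrite ler1n.
  have d6 : 6 <= 6 + 4 / n%:R + 1 / n%:R ^+ 2 :> R.
    by rewrite -addrA lerDl addr_ge0 // divr_ge0 // ?exprn_ge0.
  rewrite ler_expR lerN2 -mulrA ler_wpM2l ?sqr_ge0 //.
  move: n%:R (6 + _ + _) N1 d6 => N D N1 d6.
  (* Since [N >= 1] gives [N <= 2 * N - 1], the stated denominator is at least [24 * N], so the
     factor of [t ^+ 2] is below 1/2. *)
  have ND : N * 6 <= (2 * N - 1) * D by apply: ler_pM; lra.
  rewrite -mulrA; set M := _ * D in ND *.
  by rewrite ler_pdivrMr; lra.
split.
- apply: (@le_trans _ _ (expR (- (t ^+ 2 / 2)))%:E); last by rewrite lee_fin.
  apply: (W1_tail (n1 := n1) (A := fun s => t <= W1 R n1 s) n_gt0 pi_unif) => s ts.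
  by rewrite expr2 ler_pM2l.
- apply: (@le_trans _ _ (expR (- (t ^+ 2 / 2)))%:E); last by rewrite lee_fin.
  rewrite -(sqrrN t).
  apply: (W1_tail (n1 := n1) (A := fun s => W1 R n1 s <= - t) n_gt0 pi_unif) => s ts.
  by rewrite expr2 ler_nM2l // oppr_lt0.
Qed.
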